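(* Let $R$ be an infinite integral domain of zero characteristic whose additive group $R^+$ is finitely generated, and let $R^*$ denote the group of invertible elements of $R$. If $n$ is a positive integer with $n>2|R^*|$ (in particular $R^*$ is finite), then the group $\mathrm{UT}_n(R)$ of upper unitriangular $n\times n$ matrices over $R$ possesses the $R_\infty$-property, i.e. $R(\varphi)=\infty$ for every group automorphism $\varphi$ of $\mathrm{UT}_n(R)$.
   Context: An integral domain is an associative commutative ring with unit and without zero divisors. $\mathrm{UT}_n(R)$ is the group (under matrix multiplication) of $n\times n$ matrices over $R$ with $1$ on the diagonal, $0$ below the diagonal and arbitrary entries above the diagonal. For a group $G$ and an automorphism $\varphi$ of $G$, elements $x,y\in G$ are $\varphi$-conjugated if there is $z\in G$ with $x=zy\varphi(z)^{-1}$; this is an equivalence relation, and the number $R(\varphi)\in\mathbb{N}\cup\{\infty\}$ of its equivalence classes is the Reidemeister number of $\varphi$ (all infinite cardinalities are recorded as $\infty$). $G$ possesses the $R_\infty$-property if $R(\varphi)=\infty$ for every automorphism $\varphi$ of $G$. *)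

(* Defs.v *)
From HB Require Import structures.
From mathcomp Require Import all_boot all_order all_algebra.
From mathcomp Require Import finmap.
From mathcomp Require Import boolp classical_sets functions cardinality.

Set Implicit Arguments.
Unset Strict Implicit.
Unset Printing Implicit Defensive.

Import Order.TTheory GRing.Theory.

Local Open Scope classical_set_scope.
Local Open Scope ring_scope.

Section Reidemeister.
Variable G : groupType.
Implicit Types (phi : {multiplicative G -> G}) (x y z : G).

Definition twisted_conj phi x y : Prop :=
  exists z, x = (z * y * (phi z)^-1)%g.

Lemma twisted_conj_refl phi x : twisted_conj phi x x.
Proof.
have phi1 : phi 1%g = 1%g by apply: (@mulgI _ (phi 1%g)); rewrite -gmulfM !mulg1.
by exists 1%g; rewrite phi1 mul1g invg1 mulg1.
Qed.

Lemma twisted_conj_sym phi x y : twisted_conj phi x y -> twisted_conj phi y x.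
Proof.
have phi1 : phi 1%g = 1%g by apply: (@mulgI _ (phi 1%g)); rewrite -gmulfM !mulg1.
move=> [z ->]; exists z^-1%g.
have -> : phi z^-1%g = (phi z)^-1%g.
  by apply: (@mulgI _ (phi z)); rewrite -gmulfM !mulgV phi1.
by rewrite invgK !mulgA mulVg mul1g -mulgA mulVg mulg1.
Qed.

Lemma twisted_conj_trans phi x y z :
  twisted_conj phi x y -> twisted_conj phi y z -> twisted_conj phi x z.
Proof.
move=> [u ->] [v ->]; exists (u * v)%g.
by rewrite gmulfM invgM !mulgA.
Qed.

Definition twisted_class phi y : set G := [set x | twisted_conj phi x y].

(* Valued in N extended with infinity, which is encoded as [None]. *)
Definition Reidemeister_number phi : option nat :=
  let C := range (twisted_class phi) in
  if `[< finite_set C >] then Some #|` fset_set C| else None.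

Definition R_infty_property : Prop :=
  forall phi : {multiplicative G -> G},
    bijective phi -> Reidemeister_number phi = None.

End Reidemeister.

Definition unitriangular (R : nzRingType) n (A : 'M[R]_n) : bool :=
  [forall i : 'I_n, forall j : 'I_n,
    (j <= i)%N ==> (A i j == (i == j)%:R)].

Record UT (R : nzRingType) (n : nat) := UTMatrix {
  UTval :> 'M[R]_n;
  _ : unitriangular UTval
}.

HB.instance Definition _ (R : nzRingType) n := [isSub for @UTval R n].
HB.instance Definition _ (R : nzRingType) n := [Choice of UT R n by <:].

Lemma unitriangularP (R : nzRingType) n (A : 'M[R]_n) :
  reflect (forall i j : 'I_n, (j <= i)%N -> A i j = (i == j)%:R)
          (unitriangular A).
Proof.
apply: (iffP 'forall_forallP) => H i j.
  by move=> ji; apply/eqP/(implyP (H i j)).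
by apply/implyP => ji; apply/eqP/H.
Qed.

Section UTGroup.
Variables (R : comUnitRingType) (n : nat).
Implicit Types A B : 'M[R]_n.

Lemma unitriangular1 : unitriangular (1%:M : 'M[R]_n).
Proof. by apply/unitriangularP => i j _; rewrite mxE. Qed.

Lemma unitriangularM A B :
  unitriangular A -> unitriangular B -> unitriangular (A *m B).
Proof.
move=> /unitriangularP hA /unitriangularP hB; apply/unitriangularP => i j ji.
rewrite mxE (bigD1 i) //= hA // eqxx mul1r hB // big1 ?addr0 // => k ki.
have [lki|lik] := leqP k i; first by rewrite hA // eq_sym (negPf ki) mul0r.
have ljk : (j < k)%N := leq_ltn_trans ji lik.
by rewrite (hB k j) ?(ltnW ljk) // -val_eqE gtn_eqF // mulr0.
Qed.

Lemma unitriangular_unitmx A : unitriangular A -> A \in unitmx.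
Proof.
move=> /unitriangularP hA; rewrite unitmxE -det_tr det_trig.
  by rewrite big1 ?unitr1 // => i _; rewrite mxE hA // eqxx.
apply/is_trig_mxP => i j ij.
by rewrite mxE hA ?(ltnW ij) // -val_eqE gtn_eqF.
Qed.

Lemma unitriangularV A : unitriangular A -> unitriangular (invmx A).
Proof.
move=> uA; have AV := mulmxV (unitriangular_unitmx uA).
move/unitriangularP: uA => hA; apply/unitriangularP => i j.
have [m] := ubnP (n - i); elim: m => // m IH in i j * => him ji.
have /matrixP/(_ i j) := AV.
rewrite !mxE (bigD1 i) //= hA // eqxx mul1r big1 ?addr0 // => k ki.
have [lki|lik] := leqP k i; first by rewrite hA // eq_sym (negPf ki) mul0r.
have ljk : (j < k)%N := leq_ltn_trans ji lik.
rewrite IH ?(ltnW ljk) //; last first.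
  by rewrite -ltnS (leq_trans _ him) // ltnS ltn_sub2l.
by rewrite -val_eqE gtn_eqF // mulr0.
Qed.

Definition UT_one : UT R n := UTMatrix unitriangular1.
Definition UT_mul (A B : UT R n) : UT R n :=
  UTMatrix (unitriangularM (valP A) (valP B)).
Definition UT_inv (A : UT R n) : UT R n := UTMatrix (unitriangularV (valP A)).

Fact UT_mulA : associative UT_mul.
Proof. by move=> A B C; apply: val_inj; rewrite /= mulmxA. Qed.

Fact UT_1mul : left_id UT_one UT_mul.
Proof. by move=> A; apply: val_inj; rewrite /= mul1mx. Qed.

Fact UT_mul1 : right_id UT_one UT_mul.
Proof. by move=> A; apply: val_inj; rewrite /= mulmx1. Qed.

Fact UT_Vmul : left_inverse UT_one UT_inv UT_mul.
Proof.
by move=> A; apply: val_inj; rewrite /= mulVmx ?(unitriangular_unitmx (valP A)).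
Qed.

Fact UT_mulV : right_inverse UT_one UT_inv UT_mul.
Proof.
by move=> A; apply: val_inj; rewrite /= mulmxV ?(unitriangular_unitmx (valP A)).
Qed.

HB.instance Definition _ :=
  isGroup.Build (UT R n) UT_mulA UT_1mul UT_mul1 UT_Vmul UT_mulV.

End UTGroup.

Definition fg_zmod (V : zmodType) : Prop :=
  exists (m : nat) (s : m.-tuple V), forall v : V, inIntSpan s v.

Definition units (R : unitRingType) : set R := [set x | x \is a GRing.unit].
Arguments units R : clear implicits.

(* Main.v *)
From HB Require Import structures.
Require Import Defs.
From mathcomp Require Import all_boot all_order all_algebra.
From mathcomp Require Import zify ring.
From mathcomp Require Import finmap.
From mathcomp Require Import boolp classical_sets functions cardinality.

Set Implicit Arguments.
Unset Strict Implicit.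
Unset Printing Implicit Defensive.

Import GRing.Theory.

Local Open Scope classical_set_scope.
Local Open Scope ring_scope.

(** Let [phi] be an automorphism of [G = UT R n]. The matrices whose first
    [k - 1] superdiagonals vanish form a characteristic subgroup [Dk k], since
    [Dk k] is the centre of [G] modulo [Dk k.+1] ([Dk_char]). Reading off the
    [k]-th superdiagonal identifies [Dk k / Dk k.+1] with [R ^ (n - k)], and
    group commutators induce on these quotients the bracket [br] of strictly
    upper triangular matrices. So [phi] induces an automorphism [F] of a graded
    Lie ring, additive but in general not [R]-linear ([induced_auto]).

    The argument has two halves.

    Some [F k] fixes a nonzero vector ([graded_fixed]). In degree 1, centralizer
    conditions between degrees 1, [n - 3] and [n - 2] show that [F] keeps or
    exchanges the two ends of the superdiagonal ([keep_or_swap]); this uses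
    [n > 4], which holds because [1] and [-1] are distinct units. In the first
    case, going down from the last degrees, [F] preserves each coordinate
    hyperplane of degree 1 ([keep_monomial]), so that it multiplies the
    generator of degree 1 at position [i] by some [d_i], which has to be a unit
    ([scale_unit]). Taking brackets, the unit vector at position [j] of degree
    [k] is multiplied by [d_j ... d_(j + k - 1)]. There are more partial products
    of the [d_i] than units; two of them agree, and the product of the [d_i] in
    between is 1. In the second case this applies to [F^2], whose scales are
    needed on half of the positions only: this is where the factor 2 comes
    from. A vector [v] with [F (F v) = v] found there sits at a position which
    differs from that of [F v], so [v + F v] is nonzero and fixed by [F].

    A nonzero fixed vector in some degree makes the number of twisted conjugacy
    classes infinite ([induced_fixed_infinite]). In the least such degree [k],
    two elements of [Dk k] that are twisted conjugate differ by an element of the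
    image of [1 - F k] modulo [Dk k.+1]. With finitely many classes, the cokernel
    of [1 - F k] would be torsion. On a torsion-free group of finite rank, such
    as [R ^ (n - k)], an endomorphism with torsion cokernel is injective
    ([torsion_coker_injective]). *)

(** * Collisions and torsion cokernels *)

Lemma finite_set_collision (T : choiceType) (A : set T) (f : nat -> T) N :
  finite_set A -> (#|` fset_set A| < N)%N ->
  (forall i, (i < N)%N -> A (f i)) ->
  exists i j, [/\ (i < j)%N, (j < N)%N & f i = f j].
Proof.
move=> fA hN hf; pose s := [seq f i | i <- iota 0 N].
have /(uniqPn (f 0%N)) [i [j [ij]]] : ~~ uniq s.
  have ss : {subset s <= fset_set A}.
    by move=> _ /mapP[i hi ->]; rewrite in_fset_set // inE; apply: hf; rewrite mem_iota in hi.
  by apply/negP => us; have := uniq_leq_size us ss; rewrite size_map size_iota leqNgt hN.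
rewrite size_map size_iota => jN; have iN := ltn_trans ij jN.
by rewrite !(nth_map 0%N) ?size_iota // !nth_iota // => e; exists i, j.
Qed.

(** More integral vectors than coordinates are dependent over the rationals;
    clearing denominators gives an integral relation. *)
Lemma int_dependency (T : finType) (C : 'I_(#|T|.+1) -> T -> int) :
  exists2 a : 'I_(#|T|.+1) -> int, exists l, a l != 0 &
    forall t, \sum_l a l * C l t = 0.
Proof.
pose M : 'M[rat]_(#|T|.+1, #|T|) := \matrix_(l, t) (C l (enum_val t))%:~R.
have : kermx M != 0.
  by rewrite -mxrank_eq0 mxrank_ker -lt0n subn_gt0 ltnS rank_leq_col.
case/rowV0Pn => x /sub_kermxP xM x0.
pose a l := numq (x 0 l) * \prod_(l' | l' != l) denq (x 0 l').
pose d := \prod_l denq (x 0 l).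
have aE l : (a l)%:~R = x 0 l * d%:~R :> rat.
  have -> : d = denq (x 0 l) * \prod_(l' | l' != l) denq (x 0 l') by rewrite /d (bigD1 l).
  by rewrite !intrM numqE mulrA.
have d0 : d%:~R != 0 :> rat.
  by rewrite intr_eq0; apply/prodf_neq0 => l _; apply: denq_neq0.
exists a.
  case/rV0Pn: x0 => l xl; exists l.
  by rewrite -(intr_eq0 rat) aE mulf_neq0.
move=> t; have /rowP/(_ (enum_rank t)) := xM; rewrite !mxE => e.
have step : \sum_l (a l * C l t)%:~R = (\sum_l x 0 l * M l (enum_rank t)) * d%:~R :> rat.
  rewrite mulr_suml; apply: eq_bigr => l _.
  by rewrite intrM aE mxE enum_rankK mulrAC.
by apply/eqP; rewrite -(intr_eq0 rat) raddf_sum /= step e mul0r.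
Qed.

(** Lift a kernel vector [v] along [E] repeatedly, up to nonzero integers:
    [E v' ~ v], [E v'' ~ v'], and so on. Applying powers of [E] to a linear
    relation shows that these vectors are independent, which is absurd when the
    rank is finite. *)
Lemma torsion_coker_injective (V : zmodType) (W : V -> Prop) (E : {additive V -> V}) N :
  (forall v (c : int), W v -> c != 0 -> v *~ c = 0 -> v = 0) ->
  (forall w : 'I_N.+1 -> V, (forall l, W (w l)) ->
     exists2 a : 'I_N.+1 -> int, exists l, a l != 0 & \sum_l w l *~ a l = 0) ->
  (forall w, W w -> exists u (c : int), [/\ W u, c != 0 & E u = w *~ c]) ->
  forall v, W v -> E v = 0 -> v = 0.
Proof.
move=> tf rk tc v Wv Ev.
have /choice [h hP] w : exists u, W w -> W u /\ exists2 c : int, c != 0 & E u = w *~ c.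
  have [/tc [u [c [Wu c0 Eu]]]|nW] := pselect (W w); last by exists 0.
  by exists u; split=> //; exists c.
pose x i := iter i h v.
have Wx i : W (x i) by elim: i => //= i IH; case: (hP _ IH).
have iterM i y (c : int) : iter i E (y *~ c) = iter i E y *~ c.
  by elim: i => //= i ->; rewrite raddfMz.
have iter_sum i (y : 'I_N.+1 -> V) : iter i E (\sum_l y l) = \sum_l iter i E (y l).
  by elim: i => //= i ->; rewrite raddf_sum.
have iter_lt i j : (j < i)%N -> iter i E (x j) = 0.
  elim: i j => [|i IH] [|j] // ij; rewrite iterSr.
    by rewrite Ev; elim: i {IH ij} => //= i ->; rewrite raddf0.
  by have [_ [c _ ->]] := hP _ (Wx j); rewrite iterM IH ?mul0rz.
have iter_eq i : exists2 c : int, c != 0 & iter i E (x i) = v *~ c.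
  elim: i => [|i [c c0 IH]]; first by exists 1.
  have [_ [c' c'0 Eh]] := hP _ (Wx i); exists (c * c'); first by rewrite mulf_neq0.
  by rewrite iterSr Eh iterM IH mulrzA.
(* In a linear relation, the largest index [l] with a nonzero coefficient is
   the only one that survives the [l]-th power of [E]. *)
have [a [l0 al0] rel] := rk (fun l => x l) (fun l => Wx l).
have [l al lmax] := @arg_maxnP _ l0 (fun l => a l != 0) (@nat_of_ord _) al0.
have [c c0 xc] := iter_eq l.
apply: (tf v (c * a l)) => //; first by rewrite mulf_neq0.
rewrite mulrzA -xc -iterM -[RHS](_ : iter l E 0 = 0); last first.
  by elim: (l : nat) => //= i ->; rewrite raddf0.
rewrite -rel iter_sum (bigD1 l) //= big1 ?addr0 // => l' ne.
rewrite iterM; have [lt|ge] := ltnP l' l; first by rewrite iter_lt ?mul0rz.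
have [->|/lmax le] := eqVneq (a l') 0; first by rewrite mulr0z.
by case/eqP: ne; apply: val_inj; apply/eqP; rewrite eqn_leq ge andbT; exact: le.
Qed.

(** * Vectors supported on a superdiagonal *)

Section GradedVectors.
Variables (R : pzRingType) (n : nat).
Implicit Types (u v : nat -> R) (i j k l : nat).

(** A vector of degree [k] has coordinate [i] at the matrix position
    [(i, i + k)]. *)
Definition supp k v := forall i, (n <= i + k)%N -> v i = 0.

Definition dl i (r : R) : nat -> R := fun j => if j == i then r else 0.

(** The Lie bracket of strictly upper triangular matrices, for a vector of
    degree [k] and one of degree [l]. *)
Definition br k l u v : nat -> R :=
  fun i => u i * v (i + k)%N - v i * u (i + l)%N.

Lemma suppD k u v : supp k u -> supp k v -> supp k (u + v).
Proof. by move=> hu hv i hi; rewrite addrfctE hu // hv // addr0. Qed.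

Lemma supp0 k : supp k 0.
Proof. by []. Qed.

Lemma supp_dl k i r : (i + k < n)%N -> supp k (dl i r).
Proof. by move=> h j hj; rewrite /dl; case: eqP => // e; lia. Qed.

Lemma supp_br k l u v : supp k u -> supp l v -> supp (k + l) (br k l u v).
Proof.
move=> hu hv i hi; rewrite /br (hv (i + k)%N) ?mulr0; last lia.
by rewrite (hu (i + l)%N) ?mulr0 ?subr0 //; lia.
Qed.

End GradedVectors.

(** * The filtration of upper triangular matrices by superdiagonals *)

Section Entries.
Variables (R : comUnitRingType) (n : nat).
Implicit Types (M A B : 'M[R]_n) (i j k l : nat).

(** Entries are indexed by natural numbers and vanish outside the matrix, so
    that superdiagonals of all degrees are functions on [nat]. *)
Definition ent M i j : R :=
  if insub i is Some i' then if insub j is Some j' then M i' j' else 0 else 0.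

Lemma ent_ord M (i j : 'I_n) : ent M i j = M i j.
Proof. by rewrite /ent !valK. Qed.

Lemma ent_row_out M i j : (n <= i)%N -> ent M i j = 0.
Proof. by move=> h; rewrite /ent insubN // -leqNgt. Qed.

Lemma ent_col_out M i j : (n <= j)%N -> ent M i j = 0.
Proof. by move=> h; rewrite /ent (@insubN _ _ _ j) -?leqNgt //; case: insub. Qed.

Lemma ent_inj A B :
  (forall i j, (i < n)%N -> (j < n)%N -> ent A i j = ent B i j) -> A = B.
Proof. by move=> h; apply/matrixP => i j; rewrite -!ent_ord h. Qed.

Lemma entD A B i j : ent (A + B) i j = ent A i j + ent B i j.
Proof. by rewrite /ent; case: insub => [i'|]; [case: insub => [j'|]|]; rewrite ?addr0 ?mxE. Qed.

Lemma entN A i j : ent (- A) i j = - ent A i j.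
Proof. by rewrite /ent; case: insub => [i'|]; [case: insub => [j'|]|]; rewrite ?oppr0 ?mxE. Qed.

Lemma ent0 i j : ent 0 i j = 0.
Proof. by rewrite /ent; case: insub => [i'|] //; case: insub => // j'; rewrite mxE. Qed.

Lemma entM A B i j : ent (A *m B) i j = \sum_(l < n) ent A i l * ent B l j.
Proof.
have [hi|hi] := leqP n i.
  by rewrite ent_row_out // big1 // => l _; rewrite ent_row_out ?mul0r.
have [hj|hj] := leqP n j.
  by rewrite ent_col_out // big1 // => l _; rewrite (ent_col_out B) ?mulr0.
rewrite -[i]/(val (Ordinal hi)) -[j]/(val (Ordinal hj)) ent_ord mxE.
by apply: eq_bigr => l _; rewrite !ent_ord.
Qed.

Lemma ent1 i j : (i < n)%N -> ent 1%:M i j = (i == j)%:R.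
Proof.
move=> hi; have [hj|hj] := leqP n j.
  by rewrite ent_col_out // (_ : (i == j) = false) //; lia.
by rewrite -[i]/(val (Ordinal hi)) -[j]/(val (Ordinal hj)) ent_ord mxE.
Qed.

(** A two-sided filtration of the ring of upper triangular matrices. *)
Definition low k M := forall i j, (j < i + k)%N -> ent M i j = 0.

Lemma lowD k A B : low k A -> low k B -> low k (A + B).
Proof. by move=> a b i j h; rewrite entD a // b // addr0. Qed.

Lemma lowN k A : low k A -> low k (- A).
Proof. by move=> a i j h; rewrite entN a // oppr0. Qed.

Lemma lowM k l A B : low k A -> low l B -> low (k + l) (A *m B).
Proof.
move=> a b i j h; rewrite entM big1 // => p _.
have [hp|hp] := ltnP p (i + k); first by rewrite a // mul0r.
by rewrite (b p) ?mulr0 //; lia.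
Qed.

Lemma ent_lowM k l A B i : low k A -> low l B ->
  ent (A *m B) i (i + (k + l)) = ent A i (i + k) * ent B (i + k) (i + k + l).
Proof.
move=> a b; rewrite entM addnA.
have [hi|hi] := leqP n (i + k).
  rewrite (ent_col_out A _ hi) mul0r big1 // => p _.
  by rewrite a ?mul0r //; have := ltn_ord p; lia.
rewrite (bigD1 (Ordinal hi)) //= big1 ?addr0 // => p hp.
have {}hp : (p != i + k :> nat)%N by [].
have [hp'|hp'] := ltnP p (i + k); first by rewrite a // mul0r.
by rewrite (b p) ?mulr0 //; lia.
Qed.

End Entries.

(** * The filtration of the unitriangular group *)

Section Filtration.
Variables (R : comUnitRingType) (n : nat).
Local Notation G := (UT R n).
Implicit Types (A B : G) (u v : nat -> R) (i j k l : nat).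
Local Notation br := (@br R).
Local Notation supp := (@supp R n).

Lemma low0_UT A : low 0 (UTval A).
Proof.
move=> i j; rewrite addn0 => h.
have [hi|hi] := leqP n i; first by rewrite ent_row_out.
have hj : (j < n)%N by lia.
rewrite -[i]/(val (Ordinal hi)) -[j]/(val (Ordinal hj)) ent_ord.
have /unitriangularP -> := valP A; last by rewrite /=; lia.
by rewrite -val_eqE /= (_ : (i == j) = false) //; lia.
Qed.

Lemma ent_UT_diag A i : (i < n)%N -> ent A i i = 1.
Proof.
move=> hi; rewrite -[i]/(val (Ordinal hi)) ent_ord.
by have /unitriangularP -> := valP A; rewrite ?eqxx.
Qed.

Definition Dk k A := low k (UTval A - 1%:M).

Definition dg k A : nat -> R := fun i => ent (UTval A - 1%:M) i (i + k).

Lemma supp_dg k A : supp k (dg k A).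
Proof. by move=> i h; rewrite /dg ent_col_out. Qed.

Lemma Dk1 A : Dk 1 A.
Proof.
move=> i j h; have [hi|hi] := leqP n i; first by rewrite ent_row_out.
rewrite entD entN ent1 //; case: eqP => [<-|ne]; first by rewrite ent_UT_diag // subrr.
by rewrite subr0 low0_UT //; lia.
Qed.

Lemma Dk_widen k l A : (k <= l)%N -> Dk l A -> Dk k A.
Proof. by move=> h a i j hj; rewrite a //; lia. Qed.

Lemma Dk_one k : Dk k (1%g : G).
Proof. by move=> i j h; rewrite subrr ent0. Qed.

Lemma Dk_top A : Dk n A -> A = 1%g.
Proof.
move=> a; apply: val_inj => /=; apply/eqP; rewrite -subr_eq0; apply/eqP/ent_inj => i j hi hj.
by rewrite a ?ent0 //; lia.
Qed.

Lemma DkS k A : Dk k A -> dg k A = 0 -> Dk k.+1 A.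
Proof.
move=> a d i j h; have [e|ne] := eqVneq j (i + k)%N; last by rewrite a //; lia.
by rewrite e -[LHS]/(dg k A i) d.
Qed.

Lemma dg_DkS k A : Dk k.+1 A -> dg k A = 0.
Proof. by move=> a; apply/funext => i; rewrite /dg a //; lia. Qed.

Lemma low_mulr_UT k M A : low k M ->
  low k (M *m UTval A) /\ forall i, ent (M *m UTval A) i (i + k) = ent M i (i + k).
Proof.
move=> m; have hA := low0_UT A; split; first by rewrite -[k]addn0; apply: lowM.
move=> i; have := ent_lowM i m hA; rewrite !addn0 => ->.
have [h|h] := leqP n (i + k); first by rewrite (ent_col_out M _ h) mul0r.
by rewrite ent_UT_diag // mulr1.
Qed.

Lemma low_mull_UT k M A : low k M ->
  low k (UTval A *m M) /\ forall i, ent (UTval A *m M) i (i + k) = ent M i (i + k).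
Proof.
move=> m; have hA := low0_UT A; split; first by rewrite -[k]add0n; apply: lowM.
move=> i; have := ent_lowM i hA m; rewrite add0n !addn0 => ->.
have [h|h] := leqP n i; first by rewrite (ent_row_out M _ h) mulr0.
by rewrite ent_UT_diag // mul1r.
Qed.

Lemma DkM k A B : Dk k A -> Dk k B -> Dk k (A * B)%g.
Proof.
move=> a b; have [a1 _] := low_mulr_UT B a; rewrite /Dk.
have -> : UTval (A * B)%g - 1%:M = (UTval A - 1%:M) *m UTval B + (UTval B - 1%:M).
  by rewrite mulmxBl mul1mx addrA subrK.
exact: lowD.
Qed.

Lemma dgM k A B : Dk k A -> Dk k B -> dg k (A * B)%g = dg k A + dg k B.
Proof.
move=> a b; have [_ a1] := low_mulr_UT B a; apply/funext => i.
rewrite addrfctE /dg -a1 -entD; congr (ent _ i _).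
by rewrite mulmxBl mul1mx addrA subrK.
Qed.

Lemma UTvalM A B : UTval (A * B)%g = UTval A *m UTval B.
Proof. by []. Qed.

Lemma UT_invE A : UTval A *m UTval A^-1%g = 1%:M.
Proof. exact: (congr1 (fun B : G => UTval B) (mulgV A)). Qed.

Lemma UTinv_sub1 A : UTval A^-1%g - 1%:M = - ((UTval A - 1%:M) *m UTval A^-1%g).
Proof. by rewrite mulmxBl mul1mx UT_invE opprB. Qed.

Lemma DkV k A : Dk k A -> Dk k A^-1%g.
Proof.
move=> a; have [a1 _] := low_mulr_UT A^-1%g a.
by rewrite /Dk UTinv_sub1; apply: lowN.
Qed.

Lemma dgV k A : Dk k A -> dg k A^-1%g = - dg k A.
Proof.
move=> a; have [_ a1] := low_mulr_UT A^-1%g a; apply/funext => i.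
by rewrite opprfctE /dg -a1 UTinv_sub1 entN.
Qed.

(** Because [A B - B A] does not change when the identity is subtracted from
    [A] and [B]. The unitriangular factors on the left do not affect the first
    nonzero superdiagonal, which is thus that of a ring commutator. *)
Lemma commg_sub1 A B : UTval [~ A, B]%g - 1%:M =
  UTval A^-1%g *m (UTval B^-1%g *m ((UTval A - 1%:M) *m (UTval B - 1%:M)
     - (UTval B - 1%:M) *m (UTval A - 1%:M))).
Proof.
set C := (X in _ *m (_ *m X)).
have -> : C = UTval (A * B)%g - UTval (B * A)%g.
  have cancel (x y a b c : 'M[R]_n) : (x - a - (b - c)) - (y - b - (a - c)) = x - y.
    rewrite -[x - a - _]addrA -opprD -[y - b - _]addrA -opprD (addrCA b).
    by rewrite opprB [_ + (_ - y)]addrA subrK.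
  by rewrite /C !mulmxBl !mulmxBr !mul1mx !mulmx1 cancel.
rewrite !mulmxBr -!UTvalM /commg /conjg.
by congr (UTval _ - _); rewrite ?mulgA // -mulgA -invgM mulVg.
Qed.

Lemma Dk_comm k l A B : Dk k A -> Dk l B -> Dk (k + l) [~ A, B]%g.
Proof.
move=> a b; rewrite /Dk commg_sub1.
apply: (low_mull_UT _ _).1; apply: (low_mull_UT _ _).1.
by apply: lowD; [apply: lowM | apply: lowN; rewrite addnC; apply: lowM].
Qed.

Lemma dg_comm k l A B : Dk k A -> Dk l B ->
  dg (k + l) [~ A, B]%g = br k l (dg k A) (dg l B).
Proof.
move=> a b; apply/funext => i; rewrite {1}/dg commg_sub1.
have ab := lowM a b; have := lowM b a; rewrite addnC => ba.
have c := lowD ab (lowN ba).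
rewrite (low_mull_UT _ (low_mull_UT _ c).1).2 (low_mull_UT _ c).2 entD entN.
by rewrite (ent_lowM i a b) (addnC k l) (ent_lowM i b a).
Qed.

(** A section of [dg k] on the vectors of degree [k > 0]. *)
Definition lay_mx k v : 'M[R]_n :=
  \matrix_(i, j) (if (0 < k)%N && (j == i + k :> nat)%N then v i else (i == j)%:R).

Lemma unitriangular_lay k v : unitriangular (lay_mx k v).
Proof.
apply/unitriangularP => i j h; rewrite mxE; case: ifP => // /andP[k0 /eqP e].
by lia.
Qed.

Definition lay k v : G := UTMatrix (unitriangular_lay k v).

Lemma ent_lay k v i j : (0 < k)%N -> (i < n)%N -> (j < n)%N ->
  ent (UTval (lay k v) - 1%:M) i j = if j == (i + k)%N then v i else 0.
Proof.
move=> k0 hi hj; rewrite -[i]/(val (Ordinal hi)) -[j]/(val (Ordinal hj)) ent_ord.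
rewrite !mxE k0 /=; case: eqP => [e|_]; last by rewrite subrr.
by rewrite -val_eqE /= (_ : (i == j) = false) ?subr0 //; lia.
Qed.

Lemma Dk_lay k v : (0 < k)%N -> Dk k (lay k v).
Proof.
move=> k0 i j h; have [hi|hi] := leqP n i; first by rewrite ent_row_out.
have [hj|hj] := leqP n j; first by rewrite ent_col_out.
by rewrite ent_lay // (_ : (j == _) = false) //; lia.
Qed.

Lemma dg_lay k v i : (0 < k)%N -> (i + k < n)%N -> dg k (lay k v) i = v i.
Proof. by move=> k0 h; rewrite /dg ent_lay ?eqxx //; lia. Qed.

Lemma dg_lay_supp k v : (0 < k)%N -> supp k v -> dg k (lay k v) = v.
Proof.
move=> k0 hv; apply/funext => i; have [h|h] := leqP n (i + k).
  by rewrite hv // supp_dg.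
exact: dg_lay.
Qed.

End Filtration.

(** * Graded automorphisms *)

Section Graded.
Variables (R : idomainType) (n : nat).
Implicit Types (u v a x : nat -> R) (i j k l : nat) (F G : nat -> (nat -> R) -> nat -> R).
Local Notation br := (@br R).
Local Notation supp := (@supp R n).
Local Notation dl := (@dl R).

(** [F k] acts on the vectors of degree [k], for [k > 0]. *)
Record graded_morphism F : Prop := GradedMorphism {
  gmor_supp : forall k v, supp k (F k v);
  gmor_add : forall k u v, (0 < k)%N -> supp k u -> supp k v ->
    F k (u + v) = F k u + F k v;
  gmor_br : forall k l u v, (0 < k)%N -> (0 < l)%N -> supp k u -> supp l v ->
    F (k + l)%N (br k l u v) = br k l (F k u) (F l v) }.

Record graded_auto F G : Prop := GradedAuto {
  gaut_mor : graded_morphism F;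
  gaut_inv_mor : graded_morphism G;
  gautK : forall k v, (0 < k)%N -> supp k v -> G k (F k v) = v;
  gautVK : forall k v, (0 < k)%N -> supp k v -> F k (G k v) = v }.

Lemma gmor0 F k : graded_morphism F -> (0 < k)%N -> F k 0 = 0.
Proof.
move=> mF k0; have := gmor_add mF k0 (@supp0 R n k) (@supp0 R n k).
by rewrite addr0 => /eqP; rewrite -subr_eq0 opprD addrA subrr sub0r oppr_eq0 => /eqP.
Qed.

Lemma gaut_sym F G : graded_auto F G -> graded_auto G F.
Proof. by case=> *; split. Qed.

Lemma gmor_comp F F' : graded_morphism F -> graded_morphism F' ->
  graded_morphism (fun k v => F k (F' k v)).
Proof.
move=> m m'; split=> [k v|k u v k0 hu hv|k l u v k0 l0 hu hv].
- exact: gmor_supp.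
- by rewrite (gmor_add m') // (gmor_add m) //; apply: (gmor_supp m').
- by rewrite (gmor_br m') // (gmor_br m) //; apply: (gmor_supp m').
Qed.

Lemma gaut_comp F G F' G' : graded_auto F G -> graded_auto F' G' ->
  graded_auto (fun k v => F k (F' k v)) (fun k v => G' k (G k v)).
Proof.
move=> [m w e e'] [m' w' f f']; split.
- exact: gmor_comp.
- exact: gmor_comp.
- by move=> k v k0 hv; rewrite e ?f //; apply: (gmor_supp m').
- by move=> k v k0 hv; rewrite f' ?e' //; apply: (gmor_supp w).
Qed.

(** Induced by the automorphism [A |-> J A^-T J] of the group, where [J] is the
    antidiagonal permutation matrix: the inverse contributes the sign [-1] in
    degree 1, hence [(-1) ^+ k.-1] in degree [k]. *)
Definition flip k v : nat -> R :=
  fun i => if (i + k < n)%N then (-1) ^+ k.-1 * v (n - 1 - k - i)%N else 0.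

Lemma flipK k v : supp k v -> flip k (flip k v) = v.
Proof.
move=> hv; apply/funext => i; rewrite /flip; case: ltnP => h; last by rewrite hv.
rewrite ifT; last lia.
by rewrite mulrA -exprD -signr_odd oddD addbb mul1r; congr v; lia.
Qed.

Lemma flip_mor : graded_morphism flip.
Proof.
split=> [k v i h|k u v k0 hu hv|k l u v k0 l0 hu hv].
- by rewrite /flip ifF //; lia.
- apply/funext => i; rewrite /flip !addrfctE; case: ltnP => _; last by rewrite addr0.
  by rewrite mulrDr.
- apply/funext => i; rewrite /flip /br; case: ltnP => h; last first.
    by rewrite [X in _ * X]ifF ?[X in _ - _ * X]ifF ?mulr0 ?subrr //; lia.
  rewrite !ifT; try lia.
  have -> : (n - 1 - (k + l) - i + k = n - 1 - l - i)%N by lia.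
  have -> : (n - 1 - (k + l) - i + l = n - 1 - k - i)%N by lia.
  have -> : (n - 1 - l - (i + k) = n - 1 - (k + l) - i)%N by lia.
  have -> : (n - 1 - k - (i + l) = n - 1 - (k + l) - i)%N by lia.
  have -> : (-1) ^+ (k + l).-1 = - ((-1) ^+ k.-1 * (-1) ^+ l.-1) :> R.
    by rewrite -exprD -[RHS]mulN1r -exprS; congr (_ ^+ _); lia.
  by ring.
Qed.

Lemma flip_auto : graded_auto flip flip.
Proof. by split; try exact: flip_mor; move=> k v _; apply: flipK. Qed.

Lemma flip1E a i : (i.+1 < n)%N -> flip 1 a i = a (n - 2 - i)%N.
Proof. by move=> h; rewrite /flip addn1 h expr0 mul1r; congr a; lia. Qed.

(** Bracketing with the generators [dl j 1] detects every coordinate from row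
    [p] on; for [p = 0] this says that the centre lies in the last degree. *)
Lemma br_detect k p u : (0 < k)%N -> (p + k.+1 < n)%N -> supp k u ->
  (forall v, supp 1 v -> forall i, (p <= i)%N -> br k 1 u v i = 0) ->
  forall i, (p <= i)%N -> u i = 0.
Proof.
move=> k0 hp hu h i hi; have [hik|hik] := leqP n (i + k); first exact: hu.
have [lt|ge] := ltnP (i + k).+1 n.
  have := h (dl (i + k) 1) (supp_dl _ _) i hi; rewrite /br /dl eqxx.
  rewrite (_ : (i == _) = false) ?mul0r ?subr0 ?mulr1; first by apply; lia.
  by lia.
have := h (dl (i - 1) 1) (supp_dl _ _) (i - 1)%N _; rewrite /br /dl eqxx subnK; last lia.
rewrite (_ : (_ == _) = false) ?mulr0 ?sub0r ?mul1r; last lia.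
by move=> e; apply/eqP; rewrite -oppr_eq0 e //; lia.
Qed.

(** * Monomial graded automorphisms *)

(** A coordinate axis is an intersection of coordinate hyperplanes, so [F] also
    maps every axis of degree 1 into itself. *)
Definition monomial F := forall k a, (k < n.-1)%N -> supp 1 a -> a k = 0 -> F 1%N a k = 0.

Lemma monomialE F k (r : R) : monomial F -> graded_morphism F -> (k < n.-1)%N ->
  F 1%N (dl k r) = dl k (F 1%N (dl k r) k).
Proof.
move=> mono m hk; apply/funext => i; rewrite {2}/dl; case: eqP => [->//|ne].
have [hi|hi] := leqP n (i + 1); first exact: gmor_supp hi.
apply: mono; [lia|by apply: supp_dl; lia|by rewrite /dl; case: eqP].
Qed.

Arguments monomialE [F k] r.

Definition scale F k := F 1%N (dl k 1) k.

Lemma br_dl k i r s : (0 < k)%N -> br k 1 (dl i r) (dl (i + k) s) = dl i (r * s).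
Proof.
move=> k0; apply/funext => j; rewrite /br /dl eqn_add2r.
rewrite [X in _ - X](_ : _ = 0) ?subr0; last first.
  by do 2 case: eqP => ? ; rewrite ?mulr0 ?mul0r //; lia.
by case: eqP; rewrite ?mul0r.
Qed.

(** The unit vector at [j] in degree [k] is the iterated bracket of the
    generators of degree 1 at positions [j], ..., [j + k - 1]. *)
Lemma monomial_dl F k j : monomial F -> graded_morphism F -> (0 < k)%N -> (j + k < n)%N ->
  F k (dl j 1) = dl j (\prod_(j <= i < j + k) scale F i).
Proof.
move=> mono m; elim: k => // -[_ _ hj|k IH _ hj].
  by rewrite addn1 big_nat1 monomialE //; lia.
have -> : dl j 1 = br k.+1 1 (dl j 1) (dl (j + k.+1) 1) by rewrite br_dl // mulr1.
rewrite -[in LHS]addn1 (gmor_br m) //; try by apply: supp_dl; lia.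
rewrite IH //; last lia.
rewrite monomialE //; last lia.
by rewrite br_dl // [in RHS]addnS big_nat_recr //= leq_addr.
Qed.

(** Let [F] send [r] at position [j] of degree 1 to [f_j r]. Comparing brackets
    in degree 2, [f_j r * f_(j+1) s] depends only on [r * s]. For [r] and [s]
    with [f_j r = f_(j+1) s = 1], the element [f_j 1] thus divides
    [f_j r * f_(j+1) s = 1], and so does [f_(j+1) 1]. *)
Lemma scale_unit F G k : graded_auto F G -> monomial F -> (2 < n)%N -> (k < n.-1)%N ->
  scale F k \is a GRing.unit.
Proof.
move=> FG mono n2 hk; have [m w e e'] := FG.
have onto j : (j < n.-1)%N -> exists r, F 1%N (dl j r) j = 1.
  move=> hj; have sd : supp 1 (dl j 1) by apply: supp_dl; lia.
  exists (G 1%N (dl j 1) j); set g := G _ _.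
  have sg : supp 1 g by apply: gmor_supp.
  have sd' r : supp 1 (dl j r) by apply: supp_dl; lia.
  have E : g = dl j (g j) + (g + dl j (- g j)).
    apply/funext => i; rewrite !addrfctE /dl; case: eqP => [->|_].
      by rewrite [g j - _]subrr addr0.
    by rewrite addr0 add0r.
  have : F 1%N g j = 1 by rewrite e' // /dl eqxx.
  rewrite E (gmor_add m) //; last by apply: suppD.
  rewrite addrfctE [X in _ + X]mono ?addr0 //; first by rewrite -E.
    exact: suppD.
  by rewrite addrfctE /dl eqxx subrr.
have f2 j r s : (j.+1 < n.-1)%N ->
    F 1%N (dl j r) j * F 1%N (dl j.+1 s) j.+1 = F 2%N (dl j (r * s)) j.
  move=> hj; rewrite -(@br_dl 1) // addn1 -[2%N]/(1 + 1)%N.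
  rewrite (gmor_br m) //; try by apply: supp_dl; lia.
  have hj' : (j < n.-1)%N by lia.
  rewrite (monomialE r mono m hj') (monomialE s mono m hj).
  by rewrite -[in X in br _ _ _ X](addn1 j) br_dl // addn1 /dl !eqxx.
rewrite /scale; apply/unitrPr; have [lt|ge] := ltnP k.+1 n.-1.
  have [r hr] := onto k hk; have [s hs] := onto k.+1 lt.
  exists (F 1%N (dl k.+1 (r * s)) k.+1).
  by rewrite f2 // mul1r -f2 // hr hs mulr1.
have hk1 : (k.-1.+1 = k)%N by lia.
have [r hr] := onto k.-1 ltac:(lia); have [s hs] := onto k hk.
have f2k t t' : F 1%N (dl k.-1 t) k.-1 * F 1%N (dl k t') k = F 2%N (dl k.-1 (t * t')) k.-1.
  by rewrite -f2 ?hk1 //; lia.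
exists (F 1%N (dl k.-1 (r * s)) k.-1).
by rewrite mulrC f2k mulr1 -f2k hr hs mulr1.
Qed.

End Graded.

(** * Graded automorphisms preserve or reverse the superdiagonal *)

Section Ends.
Variables (R : idomainType) (n : nat).
Implicit Types (u v a x : nat -> R) (i j k l : nat) (F G : nat -> (nat -> R) -> nat -> R).
Local Notation br := (@br R).
Local Notation supp := (@supp R n).
Local Notation dl := (@dl R).
Local Notation graded_morphism := (@graded_morphism R n).
Local Notation graded_auto := (@graded_auto R n).
Local Notation flip := (@flip R n).
Local Notation monomial := (@monomial R n).
Hypothesis n5 : (4 < n)%N.

Definition ends a := [/\ supp 1 a, a 0%N = 0 & a (n - 2)%N = 0].

(** Vanishing at both ends amounts to commuting with degree [n - 2]. *)
Lemma ends_auto F G a : graded_auto F G -> ends a -> ends (F 1%N a).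
Proof.
case=> m w e e' [sa a0 a2].
have z x : supp (n - 2) x -> br 1 (n - 2) (F 1%N a) x = 0.
  move=> sx; rewrite -(e' (n - 2)%N x) //; last lia.
  rewrite -(gmor_br m) //; [|lia|exact: gmor_supp].
  rewrite -[RHS](gmor0 (k := 1 + (n - 2)) m) //; congr (F _ _); apply/funext => i.
  rewrite /br; case: i => [|i]; first by rewrite add0n a0 a2 mul0r mulr0 subr0.
  by rewrite (gmor_supp w) ?mulr0 ?sub0r ?(sa (_ + _)%N) ?mulr0 ?oppr0 //; lia.
split; first exact: gmor_supp.
- have sd : supp (n - 2) (dl 1 1) by apply: supp_dl; lia.
  have := congr1 (fun f => f 0%N) (z _ sd).
  by rewrite /br /dl /= mulr1 mul0r subr0.
- have sd : supp (n - 2) (dl 0 1) by apply: supp_dl; lia.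
  have /eqP := congr1 (fun f => f 0%N) (z _ sd).
  by rewrite /br /dl /= mulr0 mul1r sub0r oppr_eq0 => /eqP.
Qed.

Lemma br_ends a x : ends a -> supp (n - 3) x -> br 1 (n - 3) a x =
  (fun i => if i == 0%N then - (x 0%N * a (n - 3)%N)
            else if i == 1%N then a 1%N * x 2%N else 0).
Proof.
move=> [sa a0 a2] sx; apply/funext => -[|[|i]]; rewrite /br /=.
- by rewrite a0 mul0r sub0r.
- by rewrite (_ : (1 + (n - 3) = n - 2)%N) ?a2 ?mulr0 ?subr0 //; lia.
- by rewrite (sx (_ + 1)%N) ?(sa (_ + (_ - _))%N) ?mulr0 ?subr0 //; lia.
Qed.

Lemma ends_dl p r : (0 < p < n - 2)%N -> ends (dl p r).
Proof.
move=> h; split; first by apply: supp_dl; lia.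
  by rewrite /dl; case: eqP => // ?; lia.
by rewrite /dl; case: eqP => // ?; lia.
Qed.

(** The two hyperplanes of [ends] are exchanged by the reflection, so only
    their union can be characterized by brackets. They are distinct as
    [n > 4]. *)
Definition thin a := a 1%N = 0 \/ a (n - 3)%N = 0.

(** Within [ends], bracketing with degree [n - 3] only sees the coordinates at
    [1] and [n - 3]. If both are nonzero, what commutes with [a] in degree
    [n - 3] commutes with all of [ends]. *)
Lemma thinP a : ends a -> thin a <-> exists x,
  [/\ supp (n - 3) x, br 1 (n - 3) a x = 0 &
      exists2 b, ends b & br 1 (n - 3) b x <> 0].
Proof.
move=> ea; split=> [[a1|a3]|[x [sx ax [b eb bx]]]].
- have s2 : supp (n - 3) (dl 2 1) by apply: supp_dl; lia.
  exists (dl 2 1); split=> //.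
    by rewrite br_ends //; apply/funext => i; rewrite a1 /dl /= !mul0r oppr0 !if_same.
  have eb : ends (dl 1 1) by apply: ends_dl; lia.
  exists (dl 1 1) => // /(congr1 (fun f => f 1%N)).
  by rewrite br_ends // /dl /= mulr1 => /eqP; rewrite oner_eq0.
- have s0 : supp (n - 3) (dl 0 1) by apply: supp_dl; lia.
  exists (dl 0 1); split=> //.
    by rewrite br_ends //; apply/funext => i; rewrite a3 /dl /= !mulr0 oppr0 !if_same.
  have eb : ends (dl (n - 3) 1) by apply: ends_dl; lia.
  exists (dl (n - 3) 1) => // /(congr1 (fun f => f 0%N)).
  by rewrite br_ends // /dl /= eqxx mulr1 => /eqP; rewrite oppr_eq0 oner_eq0.
- rewrite /thin; apply: contrapT => /not_orP[/eqP a1 /eqP a3]; apply: bx.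
  move: ax; rewrite !br_ends // => ax.
  have /eqP := congr1 (fun f => f 0%N) ax; have /eqP := congr1 (fun f => f 1%N) ax.
  rewrite /= oppr_eq0 !mulf_eq0 (negPf a1) (negPf a3) orbF /= => /eqP -> /eqP ->.
  by apply/funext => i; rewrite mul0r mulr0 oppr0 !if_same.
Qed.

Lemma thin_auto F G a : graded_auto F G -> ends a -> thin a -> thin (F 1%N a).
Proof.
move=> FG ea /(thinP ea) [x [sx ax [b eb bx]]].
have [m w e e'] := FG; have n3 : (0 < n - 3)%N by lia.
apply/(thinP (ends_auto FG ea)); exists (F (n - 3)%N x); split.
- exact: gmor_supp.
- by rewrite -(gmor_br m) //; [rewrite ax (gmor0 m) | case: ea].
- exists (F 1%N b); first exact: ends_auto FG eb.
  have sb : supp 1 b by case: eb.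
  rewrite -(gmor_br m) // => z; apply: bx.
  by rewrite -[LHS](e (1 + (n - 3))%N) ?z ?(gmor0 w) //; apply: supp_br.
Qed.

Definition maps_zero F p q := forall a, ends a -> a p = 0 -> F 1%N a q = 0.

Lemma endsD a b : ends a -> ends b -> ends (a + b).
Proof.
move=> [sa a0 a2] [sb b0 b2]; split; first exact: suppD.
  by rewrite addrfctE a0 b0 addr0.
by rewrite addrfctE a2 b2 addr0.
Qed.

(** A subgroup contained in the union of two subgroups lies in one of them. *)
Lemma maps_zero_dichotomy F G p : graded_auto F G -> p = 1%N \/ p = (n - 3)%N ->
  maps_zero F p 1 \/ maps_zero F p (n - 3).
Proof.
move=> FG hp; apply: contrapT => /not_orP[].
move=> /existsNP[a /not_implyP[ea /not_implyP[ap Fa]]].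
move=> /existsNP[b /not_implyP[eb /not_implyP[bp Fb]]].
have th c : ends c -> c p = 0 -> thin (F 1%N c).
  by move=> ec cp; apply: (thin_auto FG ec); case: hp cp => ->; [left|right].
have [//|Fa'] := th a ea ap; have [Fb'|//] := th b eb bp.
have [||] := th (a + b) (endsD ea eb); first by rewrite addrfctE ap bp addr0.
  by rewrite (gmor_add (gaut_mor FG)) ?addrfctE ?Fb' ?addr0 //; [case: ea|case: eb].
by rewrite (gmor_add (gaut_mor FG)) ?addrfctE ?Fa' ?add0r //; [case: ea|case: eb].
Qed.

(** If the hyperplane at [n - 3] went into the one at [1], every value of [F]
    on [ends] would vanish at [1]: any [a] is the sum of its component at [1],
    which vanishes at [n - 3], and of an element vanishing at [1]. *)
Lemma keep_other_end F G : graded_auto F G ->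
  maps_zero F 1 1 -> maps_zero F (n - 3) (n - 3).
Proof.
move=> FG k1; have [||//] := maps_zero_dichotomy (p := n - 3) FG; first by right.
move=> k2; exfalso; have [m w e e'] := FG.
have e1 : ends (dl 1 1) by apply: ends_dl; lia.
have := ends_auto (gaut_sym FG) e1; set a := G _ _ => ea.
have Fa : F 1%N a = dl 1 1 by apply: e' => //; case: e1.
have ed r : ends (dl 1 r) by apply: ends_dl; lia.
have ad : a = dl 1 (a 1%N) + (a + dl 1 (- a 1%N)).
  apply/funext => i; rewrite !addrfctE /dl; case: eqP => [->|_].
    by rewrite [a 1%N - _]subrr addr0.
  by rewrite addr0 add0r.
have ea' := endsD ea (ed (- a 1%N)).
have /eqP := congr1 (fun f => f 1%N) Fa.
rewrite ad (gmor_add m) //; try by [case: (ed (a 1%N))|case: ea'].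
rewrite addrfctE k2 //; last by rewrite /dl; case: eqP => // ?; lia.
rewrite k1 //; last by rewrite addrfctE /dl eqxx subrr.
by rewrite addr0 /dl /= eq_sym oner_eq0.
Qed.

Definition corner k x := supp k x /\ forall i, (0 < i)%N -> x i = 0.

(** Descending induction on the degree: [x] lies in [corner k] when all its
    brackets with degree 1 lie in [corner k.+1]. *)
Lemma corner_auto F G k : graded_auto F G -> maps_zero F 1 1 ->
  (0 < k < n.-1)%N -> forall x, corner k x -> corner k (F k x).
Proof.
move=> FG keep; have [m w e e'] := FG.
have [d] := ubnP (n - k); elim: d k => // d IH k hd hk x [sx x0].
split; first exact: gmor_supp.
have n3 : (0 < n - 3)%N by lia.
have [E|ne] := eqVneq k (n - 2)%N.
  (* In degree [n - 2] the corner is the bracket of the elements of [ends]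
     vanishing at 1 with degree [n - 3]. *)
  move=> i hi; have [E1|ne1] := eqVneq i 1%N; last by rewrite (gmor_supp m) //; lia.
  have eb : ends (dl (n - 3) (- x 0%N)) by apply: ends_dl; lia.
  have sd : supp (n - 3) (dl 0 1) by apply: supp_dl; lia.
  have -> : x = br 1 (n - 3) (dl (n - 3) (- x 0%N)) (dl 0 1).
    rewrite br_ends //; apply/funext => j; rewrite /dl !eqxx /= mulr0 mul1r opprK.
    by case: eqP => [->//|j0]; rewrite x0 ?if_same //; lia.
  have -> : k = (1 + (n - 3))%N by lia.
  have sb : supp 1 (dl (n - 3) (- x 0%N)) by case: eb.
  rewrite (gmor_br m) // br_ends; [|exact: ends_auto FG eb|exact: gmor_supp].
  rewrite E1 /= keep ?mul0r // /dl; case: eqP => // ?; lia.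
apply: (@br_detect R n k 1 _ _ _ (gmor_supp m _)); [lia|lia|] => v sv i hi.
rewrite -(e' 1%N v) // -(gmor_br m) //; [|lia|exact: gmor_supp].
have cz : corner k.+1 (br k 1 x (G 1%N v)).
  split=> [|j hj]; first by rewrite -addn1; apply: supp_br => //; apply: gmor_supp.
  by rewrite /br !x0 ?mulr0 ?mul0r ?subr0 //; lia.
have hd' : (n - k.+1 < d)%N by lia.
have hk' : (0 < k.+1 < n.-1)%N by lia.
by rewrite addn1; have [_ ->] := IH _ hd' hk' _ cz.
Qed.

(** The hyperplane [a k = 0] is the centralizer of [corner k] in degree 1. *)
Lemma hyperplane_auto F G k a : graded_auto F G -> maps_zero F 1 1 ->
  (0 < k < n.-1)%N -> supp 1 a -> a k = 0 -> F 1%N a k = 0.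
Proof.
move=> FG keep hk sa ak; have [m w e e'] := FG.
have sd : supp k (dl 0 1) by apply: supp_dl; lia.
have k0 : (0 < k)%N by lia.
have [|sF cF] := corner_auto FG keep hk (x := dl 0 1).
  by split=> // -[].
have z : br k 1 (F k (dl 0 1)) (F 1%N a) = 0.
  rewrite -(gmor_br m) // -[RHS](gmor0 (k := k + 1) m) ?addn1 //; congr (F _ _).
  by apply/funext => -[|i]; rewrite /br /dl /= ?add0n ?ak !(mulr0, mul0r) subr0.
have nz : F k (dl 0 1) 0%N <> 0.
  move=> E; have : F k (dl 0 1) = 0 by apply/funext => -[|i] //; rewrite cF.
  move=> /(congr1 (G k)); rewrite e // (gmor0 w) // => /(congr1 (fun f => f 0%N)) /eqP.
  by rewrite /dl /= oner_eq0.
have /eqP := congr1 (fun f => f 0%N) z.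
rewrite /br (cF (0 + 1)%N) // mulr0 subr0 add0n mulf_eq0.
by case/orP => /eqP.
Qed.

Lemma flip_ends a : ends a -> ends (flip 1 a).
Proof. exact: ends_auto (flip_auto R n). Qed.

(** The centralizers of the corners give all hyperplanes but the one at [0],
    which is the mirror image of the one at [n - 2]. *)
Lemma keep_monomial F G : graded_auto F G -> maps_zero F 1 1 -> monomial F.
Proof.
move=> FG keep k a hk sa ak; have [k0|k0] := posnP k; last first.
  by apply: hyperplane_auto FG keep _ sa ak; lia.
have FG' := gaut_comp (flip_auto R n) (gaut_comp FG (flip_auto R n)).
have keep' : maps_zero (fun k v => flip k (F k (flip k v))) 1 1.
  move=> b eb b1; rewrite flip1E; last lia.
  have -> : (n - 2 - 1 = n - 3)%N by lia.
  apply: keep_other_end FG keep _ (flip_ends eb) _; rewrite flip1E; last lia.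
  by rewrite -[RHS]b1; congr b; lia.
have hk' : (0 < n - 2 < n.-1)%N by lia.
have sfa : supp 1 (flip 1 a) by apply: (gmor_supp (flip_mor R n)).
have fa : flip 1 a (n - 2)%N = 0 by rewrite flip1E; [rewrite subnn -k0|lia].
have := hyperplane_auto FG' keep' hk' sfa fa.
by rewrite flipK // flip1E; [rewrite subnn k0|lia].
Qed.

Lemma keep_or_swap F G : graded_auto F G ->
  maps_zero F 1 1 \/ maps_zero (fun k v => flip k (F k v)) 1 1.
Proof.
move=> FG; have [|k|s] := maps_zero_dichotomy (p := 1) FG; [by left|by left|].
right=> a ea a1; rewrite flip1E; last lia.
by have := s a ea a1; congr (F _ _ _ = _); lia.
Qed.

End Ends.

(** * A fixed vector of every graded automorphism *)

Section FixedVector.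
Variables (R : idomainType) (n : nat).
Hypothesis (n5 : (4 < n)%N) (Ufin : finite_set (units R)).
Implicit Types F G : nat -> (nat -> R) -> nat -> R.
Local Notation supp := (@supp R n).
Local Notation dl := (@dl R).
Local Notation U := #|` fset_set (units R)|.

(** Two of the partial products of the scales agree, and the product of the
    scales in between is then 1. *)
Lemma monomial_fixed F G m : graded_auto n F G -> monomial n F ->
  (U <= m)%N -> (m < n)%N ->
  exists j j', [/\ (j < j')%N, (j' <= m)%N & F (j' - j)%N (dl j 1) = dl j 1].
Proof.
move=> FG mono Um mn; pose P j := \prod_(0 <= i < j) scale F i.
have UP j : (j < m.+1)%N -> P j \is a GRing.unit.
  move=> jm; rewrite /P big_nat; apply: rpred_prod => i hi.
  by apply: (scale_unit FG mono); lia.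
have [|j [j' [jj' j'm e]]] := finite_set_collision Ufin _ UP; first by rewrite ltnS.
exists j, j'; split=> //.
have k0 : (0 < j' - j)%N by lia.
rewrite (monomial_dl mono (gaut_mor FG) k0); last lia.
have -> : (j + (j' - j) = j')%N by lia.
congr (dl j _); apply: (mulrI (UP j _)); first lia.
by rewrite mulr1 [RHS]e /P -big_cat_nat //; lia.
Qed.

Lemma graded_fixed F G : graded_auto n F G -> (2 * U < n)%N ->
  exists k v, [/\ (0 < k < n)%N, supp k v, v <> 0 & F k v = v].
Proof.
move=> FG Un; have [m w e e'] := FG.
case: (keep_or_swap n5 FG) => [keep|keepH].
  have mono := keep_monomial n5 FG keep.
  have [|j [j' [jj' j'm Fj]]] := monomial_fixed FG mono (leqnn _); first lia.
  exists (j' - j)%N, (dl j 1); split=> //; [lia|by apply: supp_dl; lia|].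
  by move/(congr1 (fun f => f j))/eqP; rewrite /dl eqxx oner_eq0.
(* Now [F] is the flip followed by a monomial automorphism [H], and [F^2] is
   itself monomial. *)
set H := (fun k v => flip n k (F k v)) in keepH.
have HG := gaut_comp (flip_auto R n) FG; rewrite -/H in HG.
have monoH := keep_monomial n5 HG keepH.
have keepFF : maps_zero n (fun k v => F k (F k v)) 1 1.
  move=> a ea a1; have ea' := ends_auto n5 FG ea.
  have Fa : F 1%N a (n - 3)%N = 0.
    have := keepH _ ea a1; rewrite /H flip1E; last lia.
    by have -> : (n - 2 - 1 = n - 3)%N by lia.
  have := keep_other_end n5 HG keepH ea' Fa; rewrite /H flip1E; last lia.
  by have -> : (n - 2 - (n - 3) = 1)%N by lia.
have FFG := gaut_comp FG FG.
have mono := keep_monomial n5 FFG keepFF.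
have [|j [j' [jj' j'm Fj]]] := monomial_fixed FFG mono (leqnn _); first lia.
set k := (j' - j)%N in Fj; have k0 : (0 < k)%N by lia.
have sd : supp k (dl j 1) by apply: supp_dl; lia.
have sF : supp k (F k (dl j 1)) by apply: gmor_supp.
exists k, (dl j 1 + F k (dl j 1)); split=> //; first lia.
- exact: suppD.
- have Fjj : F k (dl j 1) j = 0.
    rewrite -(flipK sF) -/(H k (dl j 1)).
    rewrite (monomial_dl monoH (gaut_mor HG) k0); last lia.
    rewrite /flip /dl; case: ltnP => // _; rewrite (_ : (_ == j) = false) ?mulr0 //.
    by lia.
  move/(congr1 (fun f => f j)); rewrite addrfctE Fjj /dl eqxx addr0 => /eqP.
  by rewrite oner_eq0.
- by rewrite (gmor_add m) // Fj addrC.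
Qed.

End FixedVector.

(** * Automorphisms of the unitriangular group *)

Section Induced.
Variables (R : idomainType) (n : nat).
Local Notation G := (UT R n).
Local Notation supp := (@supp R n).
Implicit Types (x : G) (f g : UMagmaMorphism.type G G) (k : nat).

(** Brackets with degree 1 detect the first nonzero superdiagonal of [x] below
    the [k]-th, so that it would survive in some commutator. *)
Lemma Dk_char k x : (k < n)%N -> (forall y : G, Dk k.+1 [~ x, y]%g) -> Dk k x.
Proof.
move=> kn cx; have: forall j, (j <= k)%N -> Dk j x; last exact.
elim=> [|[|j] IH] jk; [exact: Dk_widen (Dk1 x)|exact: Dk1|].
have xj := IH (ltnW jk); apply: DkS => //; apply/funext => i.
apply: (@br_detect R n j.+1 0 (dg j.+1 x)) => // [|i' hi'|v sv i' _]; [lia|exact: supp_dg|].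
have j1 : Dk 1 (lay n 1 v) by apply: Dk1.
rewrite -[v](dg_lay_supp (n := n) (k := 1)) // -dg_comm // addn1 dg_DkS //.
by apply: Dk_widen (cx _); lia.
Qed.

(** By descending induction on [k], as [Dk k] is determined by [Dk k.+1] through
    commutators with all of [G]. *)
Lemma Dk_auto f g k x : cancel g f -> Dk k x -> Dk k (f x).
Proof.
move=> gf; have [d] := ubnP (n - k); elim: d k x => // d IH k x hd xk.
have [nk|kn] := leqP n k.
  by rewrite (Dk_top (Dk_widen nk xk)) gmulf1; apply: Dk_one.
apply: Dk_char => // y; rewrite -[y]gf -gmulfR.
by apply: IH; [lia|rewrite -addn1; apply: Dk_comm => //; apply: Dk1].
Qed.

Definition induced (f : G -> G) k (v : nat -> R) : nat -> R := dg k (f (lay n k v)).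

(** [induced] does not depend on the chosen section: two elements of [Dk k] with
    the same [k]-th superdiagonal agree modulo [Dk k.+1]. *)
Lemma induced_dg f g k x : cancel g f -> (0 < k)%N -> Dk k x ->
  dg k (f x) = induced f k (dg k x).
Proof.
move=> gf k0 xk; rewrite /induced; set y := lay n k _.
have yk : Dk k y by apply: Dk_lay.
have yV := DkV yk.
have : Dk k.+1 (x * y^-1)%g.
  apply: DkS; first exact: DkM.
  by rewrite dgM // dgV // /y dg_lay_supp ?subrr //; apply: supp_dg.
move/(Dk_auto gf)/dg_DkS; have fx := Dk_auto gf xk; have fy := Dk_auto gf yk.
rewrite gmulfF dgM //; last exact: DkV.
by rewrite dgV // => /eqP; rewrite subr_eq0 => /eqP.
Qed.

Lemma induced_add f g k u v : cancel g f -> (0 < k)%N ->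
  induced f k (u + v) = induced f k u + induced f k v.
Proof.
move=> gf k0; have ku := Dk_lay n u k0; have kv := Dk_lay n v k0.
rewrite /induced -dgM; try exact: Dk_auto gf _.
rewrite -gmulfM (induced_dg gf k0 (DkM ku kv)) (induced_dg gf k0 (Dk_lay n _ k0)).
congr (induced _ _ _); rewrite dgM //; apply/funext => i; rewrite !addrfctE.
have [h|h] := leqP n (i + k); first by rewrite !supp_dg // addr0.
by rewrite !dg_lay.
Qed.

Lemma induced_mor f g : cancel g f -> graded_morphism n (induced f).
Proof.
move=> gf; split=> [k v|k u v k0 _ _|k l u v k0 l0 su sv]; first exact: supp_dg.
  exact: induced_add gf _.
have ku := Dk_lay n u k0; have lv := Dk_lay n v l0.
rewrite {2 3}/induced -dg_comm; try exact: Dk_auto gf _.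
rewrite -gmulfR (induced_dg gf) ?dg_comm ?dg_lay_supp //; first lia.
exact: Dk_comm.
Qed.

Lemma induced_auto f g : cancel f g -> cancel g f ->
  graded_auto n (induced f) (induced g).
Proof.
move=> fg gf; split; [exact: induced_mor gf|exact: induced_mor fg| |] => k v k0 sv;
  rewrite {2}/induced.
- rewrite -(induced_dg fg k0 (Dk_auto gf (Dk_lay n v k0))) fg.
  exact: dg_lay_supp.
- rewrite -(induced_dg gf k0 (Dk_auto fg (Dk_lay n v k0))) gf.
  exact: dg_lay_supp.
Qed.

End Induced.

(** * From a fixed vector to infinitely many classes *)

Section FiniteReidemeister.
Variables (R : idomainType) (n : nat).
Local Notation G := (UT R n).
Local Notation supp := (@supp R n).
Implicit Types (f g : UMagmaMorphism.type G G) (k : nat).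
Hypothesis R_char0 : [pchar R] =i pred0.
Hypothesis R_fg : fg_zmod R.

Lemma charf0_mulrz (v : nat -> R) (c : int) : c != 0 -> v *~ c = 0 -> v = 0.
Proof.
have nat0 (d : nat) : d != 0%N -> v *+ d = 0 -> v = 0.
  move=> d0 e; apply/funext => i; have /eqP := congr1 (fun h => h i) e.
  rewrite natmulfctE -mulr_natr mulf_eq0 => /orP[/eqP //|].
  by rewrite ((GRing.pcharf0P R).1 R_char0) (negPf d0).
case: c => d d0; first exact: nat0.
by rewrite NegzE mulrNz => /eqP; rewrite oppr_eq0 => /eqP; apply: nat0.
Qed.

Lemma mulrzfctE (v : nat -> R) (c : int) i : (v *~ c) i = v i *~ c.
Proof. by case: c => d; rewrite ?NegzE ?mulrNz ?opprfctE -!pmulrn natmulfctE. Qed.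

(** Generators of [R] give integral coordinates to the vectors of degree [k]. *)
Lemma supp_rank : exists N, forall k (w : 'I_N.+1 -> nat -> R),
  (forall l, supp k (w l)) ->
  exists2 a : 'I_N.+1 -> int, exists l, a l != 0 & \sum_l w l *~ a l = 0.
Proof.
have [m [s sP]] := R_fg; pose T : finType := ('I_n * 'I_m)%type.
exists #|T| => k w sw.
have /choice [C CP] (p : 'I_#|T|.+1 * 'I_n) : exists c : int ^ m,
  w p.1 p.2 = \sum_(i < m) s`_i *~ c i by exact: sP.
have [a a0 rel] := int_dependency (fun l (t : T) => C (l, t.1) t.2).
exists a => //; apply/funext => i; rewrite fct_sumE.
have [hi|hi] := leqP n i.
  by rewrite big1 // => l _; rewrite mulrzfctE sw ?mul0rz //; lia.
under eq_bigr => l _ do rewrite mulrzfctE (CP (l, Ordinal hi)) /= mulrz_suml.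
rewrite exchange_big big1 //= => j _.
under eq_bigr => l _ do rewrite -mulrzA mulrC.
by rewrite -mulrz_sumr (rel (Ordinal hi, j)).
Qed.

Lemma finite_twisted_collision (phi : {multiplicative G -> G}) (h : nat -> G) :
  finite_set (range (twisted_class phi)) ->
  exists l l', (l < l')%N /\ twisted_conj phi (h l) (h l').
Proof.
move=> fin; pose c l := twisted_class phi (h l).
have [|l [l' [ll' _ e]]] := @finite_set_collision _ _ c _ fin (ltnSn _).
  by move=> l _; exists (h l).
exists l, l'; split=> //.
suff : c l' (h l) by [].
by rewrite -e; apply: twisted_conj_refl.
Qed.

(** Take the least degree [k] in which the induced map fixes a nonzero vector.
    If [z] conjugates two elements of [Dk k], then its first superdiagonals are
    fixed by the induced maps, so they vanish and [z] lies in [Dk k]. Twisted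
    conjugacy in [Dk k] is thus congruence modulo the image of [1 - F k]. *)
Lemma induced_fixed_infinite (phi : {multiplicative G -> G}) f g k v :
  phi = f :> (G -> G) -> cancel f g -> cancel g f ->
  (0 < k)%N -> supp k v -> v <> 0 -> induced f k v = v ->
  ~ finite_set (range (twisted_class phi)).
Proof.
move=> phif fg gf k0 sv v0 fv fin.
pose Q j := (0 < j)%N && `[< exists u, [/\ supp j u, u <> 0 & induced f j u = u] >].
have exQ : exists j, Q j by exists k; rewrite /Q k0; apply/asboolP; exists v.
have [j /andP[j0 /asboolP[u [su u0 fu]]] jmin] := ex_minnP exQ => {k v k0 sv v0 fv exQ}.
have inj_lt i w : (0 < i < j)%N -> supp i w -> induced f i w = w -> w = 0.
  move=> /andP[i0 ij] sw fw; apply: contrapT => w0.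
  have : Q i by rewrite /Q i0; apply/asboolP; exists w.
  by move/jmin; lia.
have [N rk] := supp_rank; apply: u0.
have Eadd : zmod_morphism (fun w => induced f j w - w).
  move=> w w'; have indN : induced f j (- w') = - induced f j w'.
    apply/eqP; rewrite -addr_eq0 -(induced_add _ _ gf j0) addNr.
    have := induced_add 0 0 gf j0; rewrite addr0 => /eqP.
    by rewrite -subr_eq0 opprD addrA subrr sub0r oppr_eq0.
  by rewrite (induced_add _ _ gf j0) indN !opprD addrACA.
pose E : {additive (nat -> R) -> (nat -> R)} :=
  HB.pack (fun w => induced f j w - w) (GRing.isZmodMorphism.Build _ _ _ Eadd).
apply: (@torsion_coker_injective _ (supp j) E N) => //; last by rewrite /= fu subrr.
- by move=> w c _; apply: charf0_mulrz.
- by move=> w; apply: rk.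
move=> w sw.
(* Two multiples of [w] in the same class make a nonzero multiple of [w] a
   value of [F j - 1]. *)
pose h l : G := lay n j (w *+ l).
have hj l : Dk j (h l) by apply: Dk_lay.
have [l [l' [ll' [z hz]]]] := finite_twisted_collision h fin.
rewrite phif in hz.
have dgz i : (0 < i)%N -> (i <= j)%N -> Dk i z ->
    dg i (h l) = dg i z + dg i (h l') - induced f i (dg i z).
  move=> i0 ij zi; have hi l0 : Dk i (h l0) by apply: Dk_widen (hj l0).
  have fz := Dk_auto gf zi; have fzV := DkV fz.
  by rewrite hz dgM ?dgV ?dgM // ?(induced_dg gf) //; apply: DkM.
have zj : Dk j z.
  suff zi i : (0 < i <= j)%N -> Dk i z by apply: zi; rewrite j0 leqnn.
  elim: i => // -[_ _|i IH /andP[_ ij]]; first exact: Dk1.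
  have zi := IH (ltnW ij); apply: DkS => //; apply: (inj_lt i.+1) => //; first exact: supp_dg.
  have dgh l0 : dg i.+1 (h l0) = 0 by apply/dg_DkS/(Dk_widen ij).
  have := dgz i.+1 isT (ltnW ij) zi; rewrite !dgh.
  by rewrite addr0 => /eqP; rewrite eq_sym subr_eq0 => /eqP.
have sl l0 : supp j (w *+ l0) by move=> p hp; rewrite natmulfctE sw // mul0rn.
have := dgz j j0 (leqnn j) zj; rewrite !dg_lay_supp // => e.
exists (dg j z), (l' - l)%N%:Z; split; [exact: supp_dg|by rewrite eqz_nat; lia|].
rewrite -pmulrn mulrnBr ?(ltnW ll') // e /=.
by rewrite opprB addrCA opprD (addrC (w *+ l')) subrK.
Qed.

End FiniteReidemeister.

(** * The main theorem *)

(** A bijective multiplicative map and its inverse preserve the unit and the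
    inverses, and so commutators. *)
Lemma UMagma_of_multiplicative (G : groupType) (phi : {multiplicative G -> G}) psi :
  cancel phi psi -> cancel psi phi ->
  exists f g : UMagmaMorphism.type G G, f = phi :> (G -> G) /\ g = psi :> (G -> G).
Proof.
move=> phiK psiK.
have phiF : {morph phi : x y / (x * y^-1)%g}.
  by move=> x y; apply: (@mulIg _ (phi y)); rewrite -gmulfM !mulgVK.
have psiF : {morph psi : x y / (x * y^-1)%g}.
  by move=> x y; apply: (can_inj phiK); rewrite phiF !psiK.
pose f : UMagmaMorphism.type G G :=
  HB.pack (phi : G -> G) (isGroupMorphism.Build G G phi phiF).
pose g : UMagmaMorphism.type G G :=
  HB.pack psi (isGroupMorphism.Build G G psi psiF).
by exists f, g.
Qed.

Lemma card_units_gt1 (R : idomainType) : [pchar R] =i pred0 ->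
  finite_set (units R) -> (1 < #|` fset_set (units R)|)%N.
Proof.
move=> R0 Ufin; have ss : {subset [:: 1; -1 : R] <= fset_set (units R)}.
  by move=> x; rewrite !inE => /orP[] /eqP ->; rewrite in_fset_set // inE /units /= ?unitrN unitr1.
have := uniq_leq_size _ ss; apply; rewrite /= inE andbT -addr_eq0.
by rewrite -[1 + 1]/(2%:R) ((GRing.pcharf0P R).1 R0).
Qed.

Theorem theorem1 (R : idomainType) (n : nat)
  (R_infinite : infinite_set [set: R])
  (R_char0 : [pchar R] =i pred0)
  (R_fg : fg_zmod R)
  (R_units_finite : finite_set (units R))
  (n_gt : (2 * #|` fset_set (units R)| < n)%N) :
  R_infty_property (UT R n).
Proof.
move=> phi [psi phiK psiK]; have n5 : (4 < n)%N.
  by have := card_units_gt1 R_char0 R_units_finite; lia.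
have [f [g [fE gE]]] := UMagma_of_multiplicative phiK psiK.
have fg : cancel f g by move=> x; rewrite fE gE.
have gf : cancel g f by move=> x; rewrite fE gE.
have [k [v [/andP[k0 _] sv v0 fv]]] :=
  graded_fixed n5 R_units_finite (induced_auto fg gf) n_gt.
rewrite /Reidemeister_number; case: asboolP => // fin; exfalso.
exact (induced_fixed_infinite R_char0 R_fg (esym fE) fg gf k0 sv v0 fv fin).
Qed.
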